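(* If $|\Delta(\mathfrak{m})|=2$ and $x(d)$ is of partition $[1^2,n-1]$, then the centralizer $c_{\mathfrak{u}}(x(d))$ is characterized as follows: (1) If $\Delta(\mathfrak{m})=\{\alpha_1,\alpha_2\}$, then the elements $e_{2,n+1},\ e_{3,n+1},\ x(d)^k\ (1\le k\le n-2)$ form a basis for $c_{\mathfrak{u}}(x(d))$. (2) If $\Delta(\mathfrak{m})=\{\alpha_r,\alpha_{r+1}\}$ with $1<r<n-1$, then the elements $e_{1,r+1},\ e_{1,r+2},\ e_{r+1,n+1},\ e_{r+2,n+1},\ x(d)^k\ (1\le k\le n-2)$ form a basis for $c_{\mathfrak{u}}(x(d))$. (3) If $\Delta(\mathfrak{m})=\{\alpha_{n-1},\alpha_n\}$, then the elements $e_{1,n},\ e_{1,n+1},\ x(d)^k\ (1\le k\le n-2)$ form a basis for $c_{\mathfrak{u}}(x(d))$.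
   Context: $K$ is an algebraically closed field of characteristic $p>0$. A dimension vector is a tuple $d=(d_1,\ldots,d_\ell)$ of positive integers with $\sum_i d_i=n+1$. $\mathfrak{p}(d)=\mathfrak{m}\oplus\mathfrak{u}\subseteq\mathfrak{sl}_{n+1}(K)$ is the standard (block upper-triangular) parabolic subalgebra with diagonal block sizes $d_1,\ldots,d_\ell$, Levi factor $\mathfrak{m}$ and nilradical $\mathfrak{u}$. $\Delta=\{\alpha_1,\ldots,\alpha_n\}$, $\alpha_i=\epsilon_i-\epsilon_{i+1}$, is the set of simple roots and $\Delta(\mathfrak{m})\subseteq\Delta$ is the set of simple roots of $\mathfrak{m}$ ($\alpha_i\in\Delta(\mathfrak{m})$ iff $i,i+1$ lie in the same block). Horizontal line diagram $L_h(d)$: arrange $\ell$ columns of $d_1,\ldots,d_\ell$ dots, top-adjusted; label the dots $1,\ldots,n+1$ column by column from left to right, top to bottom in each column; join each dot by a horizontal line to the next dot to its right in the same row, if there is one (possibly skipping columns having no dot in that row). The Richardson element is $x(d)=\sum e_{i,j}$ (matrix units), summed over all horizontal lines $i - j$ of $L_h(d)$ with $i<j$. The partition of $x(d)$ is given by its Jordan block sizes on $K^{n+1}$, and $[1^2,n-1]$ means two blocks of size $1$ and one of size $n-1$. $c_{\mathfrak{u}}(x(d))=\{z\in\mathfrak{u}\mid [z,x(d)]=0\}$, and $x(d)^k$ denotes the matrix power.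
   Formalization: The formal theorem assumes n > 2; for n = 2 one has d = (3), u = 0, x(d) = 0 of partition [1^3], and the claim that e_{2,3}, e_{3,3} (or e_{1,2}, e_{1,3}) form a basis of the zero space fails. *)

(* Defs.v *)
From HB Require Import structures.
From mathcomp Require Import all_boot all_order all_algebra all_field.

Set Implicit Arguments.
Unset Strict Implicit.
Unset Printing Implicit Defensive.

Import GRing.Theory.
Local Open Scope ring_scope.

Definition is_dim_vector (n : nat) (d : seq nat) : bool :=
  all (ltn 0) d && (sumn d == n.+1)%N.

(* The dots of L_h(d) are numbered from 0 here; dot number i, i.e. the dot   *)
(* labelled i.+1, sits in column [diag_col d i] (which is also the index of   *)
(* the diagonal block containing i) and row [diag_row d i].                   *)
Definition diag_col (d : seq nat) (i : nat) : nat := reshape_index d i.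
Definition diag_row (d : seq nat) (i : nat) : nat := reshape_offset d i.

Definition is_line (n : nat) (d : seq nat) (i j : 'I_n.+1) : bool :=
  [&& diag_row d i == diag_row d j, (diag_col d i < diag_col d j)%N &
      [forall k : 'I_n.+1, (diag_row d k == diag_row d i) ==>
         ~~ (diag_col d i < diag_col d k < diag_col d j)%N]].

(* Delta(m), where i : 'I_n stands for the simple root alpha_(i.+1).          *)
Definition levi_simple_roots (n : nat) (d : seq nat) : {set 'I_n} :=
  [set i : 'I_n | diag_col d i == diag_col d i.+1].

(* The set of the simple roots alpha_r, r ranging over s; with the 1-based    *)
(* numbering alpha_1, ..., alpha_n.                                           *)
Definition simple_roots (n : nat) (s : seq nat) : {set 'I_n} :=
  [set i : 'I_n | i.+1 \in s].

Section MatrixDefs.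
Variables (K : fieldType) (n : nat).
Implicit Types (d s : seq nat) (x z : 'M[K]_n.+1).

(* The matrix unit e_{i,j} with 1-based labels, 1 <= i, j <= n.+1.            *)
Definition mx_unit (i j : nat) : 'M[K]_n.+1 :=
  delta_mx (inord i.-1) (inord j.-1).

Definition richardson d : 'M[K]_n.+1 :=
  \sum_(ij : 'I_n.+1 * 'I_n.+1 | is_line d ij.1 ij.2) delta_mx ij.1 ij.2.

Definition nilradical d : {vspace 'M[K]_n.+1} :=
  (\sum_(ij : 'I_n.+1 * 'I_n.+1 | (diag_col d ij.1 < diag_col d ij.2)%N)
     <[delta_mx ij.1 ij.2 : 'M[K]_n.+1]>)%VS.

Definition lie_bracket z x : 'M[K]_n.+1 := z *m x - x *m z.

Definition lie_bracketr x z := lie_bracket z x.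

Fact lie_bracketr_is_linear x : linear (lie_bracketr x).
Proof.
move=> a y z; rewrite /lie_bracketr /lie_bracket.
by rewrite mulmxDl mulmxDr -scalemxAl -scalemxAr scalerBr opprD addrACA.
Qed.

HB.instance Definition _ x :=
  GRing.isLinear.Build K 'M[K]_n.+1 'M[K]_n.+1 _ (lie_bracketr x)
    (lie_bracketr_is_linear x).

Definition centralizer (U : {vspace 'M[K]_n.+1}) x : {vspace 'M[K]_n.+1} :=
  (U :&: lker (linfun (lie_bracketr x)))%VS.

Lemma mem_nilradical d z :
  reflect (forall i j : 'I_n.+1, (diag_col d j <= diag_col d i)%N -> z i j = 0)
          (z \in nilradical d).
Proof.
apply: (iffP idP) => [/memv_sumP[v vP ->] i j ji | z0].
  rewrite summxE big1 // => ij lt_ij.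
  have /vlineP[a ->] := vP _ lt_ij.
  rewrite !mxE; case: eqP => [ei|_] /=; last by rewrite mulr0.
  case: eqP => [ej|_] /=; last by rewrite mulr0.
  by move: lt_ij; rewrite -ei -ej ltnNge ji.
rewrite [z]matrix_sum_delta pair_big /=.
apply: rpred_sum => -[i j] _ /=.
have [ji|ij] := leqP (diag_col d j) (diag_col d i).
  by rewrite z0 // scale0r mem0v.
rewrite memvZ //; apply: (subvP (sumv_sup (i, j) ij (subvv _))).
exact: memv_line.
Qed.

Lemma mem_centralizer (U : {vspace 'M[K]_n.+1}) x z :
  (z \in centralizer U x) = (z \in U) && (lie_bracket z x == 0).
Proof. by rewrite memv_cap memv_ker lfunE. Qed.

(* The block diagonal matrix whose diagonal blocks are the nilpotent Jordan   *)
(* blocks of sizes s`_0, s`_1, ... (meaningful when sumn s = n.+1).           *)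
Definition nilp_jordan_mx s : 'M[K]_n.+1 :=
  \matrix_(i, j) ((j == i.+1 :> nat) &&
                  (reshape_index s i == reshape_index s j))%:R.

Definition is_of_partition x s : Prop :=
  [/\ all (ltn 0) s, sumn s = n.+1 &
      x ~_{in unitmx} nilp_jordan_mx s].

End MatrixDefs.

Arguments mx_unit : clear implicits.
Arguments richardson : clear implicits.
Arguments nilradical : clear implicits.

(* Main.v *)
Require Import Defs.
From HB Require Import structures.
From mathcomp Require Import all_boot all_order all_algebra all_field.
From mathcomp Require Import zify.

Set Implicit Arguments.
Unset Strict Implicit.
Unset Printing Implicit Defensive.

Import GRing.Theory.
Local Open Scope ring_scope.

(** Two adjacent Levi roots [alpha_(a+1)], [alpha_(a+2)] force the dimension
    vector [(1, ..., 1, 3, 1, ..., 1)] with [a] leading ones: the diagram is a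
    single row of [n-1] dots with two extra dots, the labels [a+1] and [a+2]
    (counted from 0), hanging below column [a].  So [x] is one nilpotent Jordan
    block of size [n-1] running along the first row (the chain), plus two zero
    blocks, and [x ^+ k] moves the chain by [k] columns
    ([richardson_hookE], [richardson_expE]).

    Commuting with [x] propagates the entries of [z]: for chain dots [i], [j]
    with successors [i'], [j'] one has [z i' j' = z i j]; for [i] on the chain
    and [j] off it, all [z i j] vanish except in the first row; for [i] off the
    chain and [j] on it, all vanish except in the last column.  Since the two
    off-chain dots share a column, [z] in the nilradical has no entry between
    them.  Hence [z] is determined by its entries in row 0 and by those that
    the off-chain rows have in the last column ([centralizer_eq0]).

    Each of these entries, as soon as it lies above the block diagonal, is
    equal to 1 in exactly one of the claimed basis elements and to 0 in all the
    others: the matrix units account for the entries with an off-chain index,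
    and [x ^+ k] for the chain entry of row 0 in column [k] of the diagram.
    A family of elements of a subspace that is dual to a determining set of
    entries is a basis ([basis_of_pivots]); this gives [centralizer_basis],
    and the three cases of the theorem only differ in which of the four
    off-chain entries lie above the block diagonal. *)

(** * Columns and rows of a line diagram *)

Lemma reshape_index_cons h d i :
  reshape_index (h :: d) i =
    if (i < h)%N then 0%N else (reshape_index d (i - h)).+1.
Proof.
rewrite /reshape_index /=; case: ltnP => hi; first by rewrite (eqP hi).
by rewrite subSn.
Qed.

Lemma reshape_offset_cons h d i :
  reshape_offset (h :: d) i =
    if (i < h)%N then i else reshape_offset d (i - h).
Proof.
rewrite /reshape_offset reshape_index_cons; case: ltnP => hi /=.
  by rewrite subn0.
by rewrite subnDA.
Qed.

(** The positions of the dots are thus determined, by induction on the label,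
    by the set of simple roots of the Levi factor. *)
Lemma diag_step d i : all (ltn 0) d -> (i.+1 < sumn d)%N ->
  let same := diag_col d i == diag_col d i.+1 in
  (diag_col d i.+1 = diag_col d i + ~~ same)%N /\
  diag_row d i.+1 = if same then (diag_row d i).+1 else 0%N.
Proof.
rewrite /diag_col /diag_row.
elim: d i => //= h d IHd i /andP[h_gt0 d_gt0] i_lt.
rewrite !reshape_index_cons !reshape_offset_cons.
case: (ltnP i.+1 h) => [lt_i1h | le_hi1]; first by rewrite ltnW.
case: (ltnP i h) => [lt_ih | le_hi].
  have /eqP -> : (i.+1 - h == 0)%N by lia.
  by case: d d_gt0 {IHd i_lt} => [|k d] //= /andP[k_gt0 _];
    rewrite reshape_index_cons reshape_offset_cons k_gt0.
by rewrite subSn // eqSS; have [||-> ->] := IHd (i - h)%N; rewrite ?addSn //; lia.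
Qed.

(** * Bases of matrix spaces dual to a set of entries *)

(** The entries at [s] form a system of coordinates of [U] in which [b] is the
    standard basis. *)
Lemma basis_of_pivots (K : fieldType) (n : nat) (U : {vspace 'M[K]_n.+1})
    (b : 'I_n.+1 * 'I_n.+1 -> 'M[K]_n.+1) (s : seq ('I_n.+1 * 'I_n.+1)) :
    uniq s -> {in s, forall q, b q \in U} ->
    {in s &, forall q t, b q t.1 t.2 = (q == t)%:R} ->
    (forall z, z \in U -> {in s, forall q, z q.1 q.2 = 0} -> z = 0) ->
  basis_of U [seq b q | q <- s].
Proof.
move=> s_uniq bU b_dual U_det; apply/andP; split.
  apply/eqP/vspaceP => z; apply/idP/idP.
    by apply/subvP/span_subvP => _ /mapP[q qs ->]; exact: bU.
  move=> zU; pose w := \sum_(t <- s) z t.1 t.2 *: b t.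
  have w_span : w \in <<[seq b q | q <- s]>>%VS.
    rewrite /w big_seq; apply: rpred_sum => t ts.
    by rewrite rpredZ // memv_span // map_f.
  have wU : w \in U.
    by rewrite /w big_seq; apply: rpred_sum => t ts; rewrite rpredZ // bU.
  suff -> : z = w by [].
  apply/eqP; rewrite -subr_eq0; apply/eqP/U_det; first by rewrite rpredB.
  move=> q qs; rewrite !mxE summxE (bigD1_seq q) //= mxE b_dual // eqxx mulr1.
  rewrite big_seq_cond big1 ?addr0 ?subrr // => t /andP[ts tq].
  by rewrite mxE b_dual // (negPf tq) mulr0.
apply/(@freeP _ _ _ (in_tuple [seq b q | q <- s])) => c c0 i.
have lt_s (j : 'I_(size [seq b q | q <- s])) : (j < size s)%N.
  by rewrite -(size_map b).
have s_j := mem_nth (ord0, ord0) (lt_s _).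
move/matrixP/(_ (nth (ord0, ord0) s i).1 (nth (ord0, ord0) s i).2): c0.
rewrite summxE (bigD1 i) //= !mxE (nth_map (ord0, ord0)) // b_dual // eqxx mulr1.
rewrite big1 ?addr0 // => j j_i.
rewrite mxE (nth_map (ord0, ord0)) // b_dual // nth_uniq //.
by rewrite -[(j == i :> nat)]/(j == i) (negPf j_i) mulr0.
Qed.
(** * The diagram of two adjacent Levi roots *)

(** Everything is parametrised by the index [a] of the column with three dots;
    its two lower dots are those that no horizontal line reaches. *)
Definition off_chain (a i : nat) : bool := (a < i <= a.+2)%N.
(** The column of dot [i]; on the chain it is also the position in the chain. *)
Definition block_col (a i : nat) : nat := (i - minn 2 (i - a))%N.
(** The inverse of [block_col a] on the chain. *)
Definition chain_vertex (a t : nat) : nat := (t + (a < t) * 2)%N.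

Lemma block_col_inj a i j : ~~ off_chain a i -> ~~ off_chain a j ->
  block_col a i = block_col a j -> i = j.
Proof. rewrite /off_chain /block_col; lia. Qed.

Lemma chain_vertexK a t :
  ~~ off_chain a (chain_vertex a t) /\ block_col a (chain_vertex a t) = t.
Proof. rewrite /off_chain /block_col /chain_vertex; lia. Qed.

Section Hook.
Variables (K : fieldType) (n a : nat) (d : seq nat).
Hypotheses (a_lt : (a < n.-1)%N) (dimd : is_dim_vector n d).
Hypothesis levi_d : levi_simple_roots n d = simple_roots n [:: a.+1; a.+2].

Lemma diag_hook i : (i <= n)%N ->
  diag_col d i = block_col a i /\
  diag_row d i = (if off_chain a i then i - a else 0)%N.
Proof.
case/andP: dimd => d_gt0 /eqP sum_d.
elim: i => [_|i IHi i_lt].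
  rewrite /off_chain /block_col; case: d d_gt0 => [|h e] //= /andP[h_gt0 _].
  by rewrite /diag_col /diag_row reshape_index_cons reshape_offset_cons h_gt0.
have [col_i row_i] := IHi (ltnW i_lt).
have := diag_step d_gt0 (i := i); rewrite sum_d ltnS => /(_ i_lt) /=.
have /setP/(_ (Ordinal i_lt)) := levi_d; rewrite !inE /= => -> [-> ->].
rewrite col_i row_i /off_chain /block_col !eqSS.
split; [lia | do !case: ifP; lia].
Qed.

Lemma is_line_hook (i j : 'I_n.+1) :
  is_line d i j = [&& ~~ off_chain a i, ~~ off_chain a j &
                      block_col a j == (block_col a i).+1].
Proof.
have hook (k : 'I_n.+1) := diag_hook (ltn_ord k : k <= n)%N.
have [ci ri] := hook i; have [cj rj] := hook j.
rewrite /is_line ci cj ri rj.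
apply/and3P/and3P => [[/eqP rij cij /forallP no_mid] | [ni nj /eqP cij]]; last first.
  rewrite (negPf ni) (negPf nj) eqxx; split=> //; first lia.
  apply/forallP => k; have [-> _] := hook k; apply/implyP => _.
  by rewrite /block_col in cij *; lia.
have ni : ~~ off_chain a i.
  apply/negP => off_i; move: rij cij; rewrite off_i; case: ifP; move: off_i;
  by rewrite /off_chain /block_col; lia.
have nj : ~~ off_chain a j.
  apply/negP => off_j; move: rij; rewrite off_j (negPf ni); move: off_j.
  by rewrite /off_chain; lia.
(* Otherwise the chain dot in the column after that of i breaks the line. *)
split=> //; apply/negP => /negP cij'.
have k_lt : (chain_vertex a (block_col a i).+1 < n.+1)%N.
  move: (ltn_ord j) cij cij' ni nj.
  rewrite /chain_vertex /off_chain /block_col; lia.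
have := no_mid (Ordinal k_lt); have [-> ->] := hook (Ordinal k_lt) => /=.
have [on_k ->] := chain_vertexK a (block_col a i).+1.
by rewrite (negPf on_k) (negPf ni) eqxx /=; lia.
Qed.

(** * The Richardson element as a shift along the chain *)

Local Notation x := (richardson K n d).

Lemma richardson_hookE (i j : 'I_n.+1) :
  x i j = [&& ~~ off_chain a i, ~~ off_chain a j &
              block_col a j == (block_col a i).+1]%:R.
Proof.
rewrite -is_line_hook /richardson summxE.
have [ij_line | /negPf ij_noline] := boolP (is_line d i j).
  rewrite (bigD1 (i, j)) //= mxE !eqxx big1 ?addr0 // => -[k l] /andP[_ /= kl].
  by rewrite mxE -xpair_eqE [(i, j) == _]eq_sym (negPf kl).
rewrite big1 // => -[k l] /= kl_line; rewrite mxE.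
by case: eqP => // ik; case: eqP => // jl; rewrite -ik -jl ij_noline in kl_line.
Qed.

Lemma chain_vertex_le t : (t <= n.-2)%N -> (chain_vertex a t <= n)%N.
Proof. by move: a_lt; rewrite /chain_vertex; lia. Qed.

Lemma block_col_le i : (i <= n)%N -> (block_col a i <= n.-2)%N.
Proof. by move: a_lt; rewrite /block_col; lia. Qed.

Lemma chain_vertex_ex t : (t <= n.-2)%N ->
  exists2 i : 'I_n.+1, ~~ off_chain a i & block_col a i = t.
Proof.
move=> t_le; have [off_t col_t] := chain_vertexK a t.
by exists (inord (chain_vertex a t)); rewrite inordK // ltnS chain_vertex_le.
Qed.

Lemma mul_richardsonl (z : 'M[K]_n.+1) (i k j : 'I_n.+1) :
  ~~ off_chain a i -> ~~ off_chain a k -> block_col a k = (block_col a i).+1 ->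
  (x *m z) i j = z k j.
Proof.
move=> ni nk ki; rewrite mxE (bigD1 k) //= richardson_hookE ni nk ki eqxx mul1r.
rewrite big1 ?addr0 // => l lk; rewrite richardson_hookE.
case: and3P => [[_ nl /eqP li]|_]; last by rewrite mul0r.
by case/eqP: lk; apply/val_inj/(@block_col_inj a); rewrite // li ki.
Qed.

Lemma mul_richardsonr (z : 'M[K]_n.+1) (i k j : 'I_n.+1) :
  ~~ off_chain a j -> ~~ off_chain a k -> block_col a j = (block_col a k).+1 ->
  (z *m x) i j = z i k.
Proof.
move=> nj nk jk; rewrite mxE (bigD1 k) //= richardson_hookE nj nk jk eqxx mulr1.
rewrite big1 ?addr0 // => l lk; rewrite richardson_hookE.
case: and3P => [[nl _ /eqP jl]|_]; last by rewrite mulr0.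
case/eqP: lk; apply/val_inj/(@block_col_inj a) => //.
by case: (etrans (esym jk) jl).
Qed.

Lemma mul_richardsonl0 (z : 'M[K]_n.+1) (i j : 'I_n.+1) :
  off_chain a i || (block_col a i == n.-2) -> (x *m z) i j = 0.
Proof.
move=> end_i; rewrite mxE big1 // => k _; rewrite richardson_hookE.
case: and3P => [[ni _ /eqP ki]|_]; last by rewrite mul0r.
have := block_col_le (ltn_ord k : k <= n)%N.
by case/orP: end_i => [|/eqP i_end]; rewrite ?(negPf ni) // ki i_end ltnn.
Qed.

Lemma mul_richardsonr0 (z : 'M[K]_n.+1) (i j : 'I_n.+1) :
  off_chain a j || (block_col a j == 0%N) -> (z *m x) i j = 0.
Proof.
move=> end_j; rewrite mxE big1 // => k _; rewrite richardson_hookE.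
case: and3P => [[_ nj /eqP jk]|_]; last by rewrite mulr0.
by case/orP: end_j => [|/eqP j0]; rewrite ?(negPf nj) // j0 in jk *.
Qed.

Lemma richardson_expE k (i j : 'I_n.+1) : (0 < k)%N ->
  (x ^+ k) i j = [&& ~~ off_chain a i, ~~ off_chain a j &
                     block_col a j == (block_col a i + k)%N]%:R.
Proof.
elim: k i => [//|[_ i _|k IHk i _]].
  by rewrite expr1 richardson_hookE addn1.
rewrite exprS -mulmxE.
have [end_i | ] := boolP (off_chain a i || (block_col a i == n.-2)).
  rewrite mul_richardsonl0 //; case: and3P => [[ni _ /eqP ji]|//].
  have := block_col_le (ltn_ord j : j <= n)%N.
  by move: end_i; rewrite (negPf ni) /= ji => /eqP ->; lia.
rewrite negb_or => /andP[ni i_end].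
have [|l nl li] := @chain_vertex_ex (block_col a i).+1.
  by have := block_col_le (ltn_ord i : i <= n)%N; lia.
by rewrite (mul_richardsonl _ _ ni nl li) IHk // ni nl li addSnnS.
Qed.

(** * The centralizer in the nilradical *)

Local Notation c := (centralizer (nilradical K n d) x).

Lemma mem_nilradical_hook (z : 'M[K]_n.+1) :
  reflect (forall i j : 'I_n.+1, (block_col a j <= block_col a i)%N -> z i j = 0)
          (z \in nilradical K n d).
Proof.
have col_hook (k : 'I_n.+1) : diag_col d k = block_col a k.
  by have [] := diag_hook (ltn_ord k : k <= n)%N.
apply: (iffP (mem_nilradical _ _)) => z0 i j; first by rewrite -!col_hook => /z0.
by rewrite !col_hook => /z0.
Qed.

Lemma richardson_exp_centralizer k : (0 < k)%N -> x ^+ k \in c.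
Proof.
move=> k_gt0; rewrite mem_centralizer /lie_bracket mulmxE -exprSr -exprS subrr.
rewrite eqxx andbT; apply/mem_nilradical_hook => i j le_ji.
by rewrite richardson_expE //; case: and3P => // -[_ _ /eqP]; lia.
Qed.

(** Both products of the matrix unit with [x] vanish: nothing shifts into
    an off-chain dot or the first chain dot, and nothing shifts out of
    an off-chain dot or the last one. *)
Lemma delta_centralizer (i j : 'I_n.+1) :
    off_chain a i || (block_col a i == 0%N) ->
    off_chain a j || (block_col a j == n.-2) ->
    (block_col a i < block_col a j)%N ->
  delta_mx i j \in c.
Proof.
move=> end_i end_j lt_ij; rewrite mem_centralizer; apply/andP; split.
  apply/mem_nilradical_hook => k l le_lk; rewrite mxE.
  case: eqP => // ki; case: eqP => // lj.
  by rewrite ki lj leqNgt lt_ij in le_lk.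
apply/eqP/matrixP => k l; rewrite /lie_bracket !mxE !big1 ?subrr // => q _.
  rewrite mxE richardson_hookE; case: (q =P i) => [->|_]; last by rewrite mulr0.
  case: and3P => [[nk ni /eqP ik]|_]; last by rewrite mul0r.
  by move: end_i; rewrite (negPf ni) ik.
rewrite mxE richardson_hookE; case: (q =P j) => [->|_]; last by rewrite andbF mul0r.
case: and3P => [[nj nl /eqP lj]|_]; last by rewrite mulr0.
have := block_col_le (ltn_ord l : l <= n)%N.
by move: end_j; rewrite (negPf nj) lj => /eqP ->; rewrite ltnn.
Qed.

(** Comparing the entries of [z *m x] and [x *m z] moves an entry one step up
    or down the chain in both indices at once, or shows that it vanishes; the
    only entries that no such step reaches are those of the first row and those
    of the off-chain rows in the last column. *)
Lemma centralizer_eq0 (z : 'M[K]_n.+1) : z \in c ->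
    (forall i j : 'I_n.+1, (block_col a i < block_col a j)%N ->
       (i == ord0) || (off_chain a i && (j == ord_max)) -> z i j = 0) ->
  z = 0.
Proof.
rewrite mem_centralizer => /andP[/mem_nilradical_hook z_nil].
rewrite subr_eq0 => /eqP zx_xz z_pivot; apply/matrixP => i j; rewrite [RHS]mxE.
have [|lt_ij] := leqP (block_col a j) (block_col a i); first exact: z_nil.
have [off_i | on_i] := boolP (off_chain a i).
  have [j_max | j_max] := eqVneq j ord_max.
    by apply: z_pivot; rewrite // off_i j_max eqxx orbT.
  have on_j : ~~ off_chain a j.
    by move: lt_ij off_i; rewrite /off_chain /block_col; lia.
  have [|k on_k kj] := @chain_vertex_ex (block_col a j).+1.
    move: on_j lt_ij off_i j_max (ltn_ord j) a_lt; rewrite -val_eqE /=.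
    by rewrite /off_chain /block_col; lia.
  rewrite -(mul_richardsonr z i on_k on_j kj) zx_xz mul_richardsonl0 //.
  by rewrite off_i.
(* Slide up the chain to the first row: induction on the position of i. *)
elim: {i}(block_col a i) {-2}i (erefl (block_col a i)) j on_i lt_ij
    => [|t IHt] i ti j on_i lt_ij.
  apply: z_pivot => //; apply/orP; left; rewrite -val_eqE /=.
  by move: ti on_i; rewrite /off_chain /block_col; lia.
have [|k on_k kt] := @chain_vertex_ex t.
  by have := block_col_le (ltn_ord i : i <= n)%N; rewrite ti; lia.
rewrite -(mul_richardsonl z j on_k on_i) ?kt // -zx_xz.
have [off_j | on_j] := boolP (off_chain a j).
  by rewrite mul_richardsonr0 // off_j.
have [|l on_l jl] := @chain_vertex_ex (block_col a j).-1.
  by have := block_col_le (ltn_ord j : j <= n)%N; lia.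
rewrite (mul_richardsonr z k on_j on_l) ?jl; last by lia.
by apply: IHt; rewrite ?kt // jl; lia.
Qed.

(** The list [s] holds, numbered from 0, the pivots with an off-chain index;
    it is left abstract because its length depends on whether the column with
    three dots is the first, the last, or neither. *)
Lemma centralizer_basis (s : seq (nat * nat)) : uniq s ->
    (forall i j, ((i, j) \in s) =
       [&& i <= n, j <= n, off_chain a i || off_chain a j,
           block_col a i < block_col a j &
           (i == 0) || (off_chain a i && (j == n))]%N) ->
  basis_of c ([seq mx_unit K n q.1.+1 q.2.+1 | q <- s] ++
              [seq x ^+ k | k <- index_iota 1 n.-1]).
Proof.
move=> s_uniq s_mem.
(* The remaining pivots: the chain entries of row 0, one for each power of x. *)
pose T := [seq (0%N, chain_vertex a k) | k <- index_iota 1 n.-1].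
have sT_mem i j : ((i, j) \in s ++ T) =
    [&& i <= n, j <= n, block_col a i < block_col a j &
        (i == 0) || (off_chain a i && (j == n))]%N.
  rewrite mem_cat s_mem.
  have [/eqP -> | i_n0] := boolP (i == 0%N); last first.
    have -> : ((i, j) \in T) = false.
      by apply/negP => /mapP[k _ [i0]]; rewrite i0 in i_n0.
    by rewrite orbF; case: (off_chain a i); rewrite /= ?andbF.
  have -> : ((0%N, j) \in T) =
      [&& ~~ off_chain a j, 0 < block_col a j & block_col a j <= n.-2]%N.
    apply/mapP/and3P => [[k k_iota [->]] | [on_j j_gt0 j_le]].
      have [-> ->] := chain_vertexK a k.
      by rewrite mem_index_iota in k_iota; split; lia.
    exists (block_col a j); first by rewrite mem_index_iota; lia.
    congr pair; apply: (@block_col_inj a); rewrite ?(chain_vertexK a _).1 //.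
    by rewrite (chain_vertexK a _).2.
  rewrite /= andbT; have -> : block_col a 0 = 0%N by [].
  have := @block_col_le j; have := a_lt.
  by rewrite /off_chain /block_col; lia.
pose f (q : nat * nat) : 'I_n.+1 * 'I_n.+1 := (inord q.1, inord q.2).
pose b (q : 'I_n.+1 * 'I_n.+1) :=
  if off_chain a q.1 || off_chain a q.2 then delta_mx q.1 q.2
  else x ^+ block_col a q.2.
have P_mem q : (q \in [seq f t | t <- s ++ T]) =
    ((block_col a q.1 < block_col a q.2) &&
     ((q.1 == ord0) || (off_chain a q.1 && (q.2 == ord_max))))%N.
  case: q => i j /=; rewrite -!val_eqE /=.
  have <- : ((i : nat, j : nat) \in s ++ T) =
      ((block_col a i < block_col a j) &&
       ((i == 0 :> nat) || (off_chain a i && (j == n :> nat))))%N.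
    by rewrite sT_mem -(ltnS i) -(ltnS j) !ltn_ord.
  apply/mapP/idP => [[[k l] kl_sT [-> ->]] | ij_sT].
    have := kl_sT; rewrite sT_mem => /and4P[k_le l_le _ _].
    by rewrite !inordK.
  by exists (i : nat, j : nat); rewrite /f //= !inord_val.
have -> : [seq mx_unit K n q.1.+1 q.2.+1 | q <- s] ++
          [seq x ^+ k | k <- index_iota 1 n.-1] = [seq b q | q <- map f (s ++ T)].
  rewrite -map_comp map_cat -map_comp; congr cat; apply/eq_in_map.
    move=> [i j]; rewrite s_mem => /and5P[i_le j_le off_ij _ _].
    by rewrite /b /= !inordK // off_ij.
  move=> k; rewrite mem_index_iota => /andP[_ k_lt].
  have [on_k col_k] := chain_vertexK a k.
  rewrite /b /= !inordK ?ltnS ?chain_vertex_le //; last by lia.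
  by rewrite (negPf on_k) col_k.
apply: basis_of_pivots.
- rewrite map_inj_in_uniq.
    rewrite cat_uniq s_uniq map_inj_uniq ?iota_uniq ?andbT /=.
      apply/hasPn => _ /mapP[k _ ->]; rewrite s_mem.
      by rewrite (negPf (chain_vertexK a k).1) !andbF.
    by move=> k l [] /(congr1 (block_col a)); rewrite !(chain_vertexK a _).2.
  move=> [i j] [k l]; rewrite !sT_mem.
  move=> /and4P[i_le j_le _ _] /and4P[k_le l_le _ _].
  by case=> /(congr1 val) + /(congr1 val); rewrite /= !inordK // => -> ->.
- move=> [i j]; rewrite P_mem /b /= => /andP[lt_ij pivot_ij].
  case: ifP => [off_ij | _].
    have on_0 : ~~ off_chain a 0 by [].
    apply: delta_centralizer => //.
      by case/orP: pivot_ij => [/eqP -> | /andP[-> //]]; rewrite orbT.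
    case/orP: pivot_ij => [/eqP i0 | /andP[_ /eqP jn]].
      by move: off_ij; rewrite i0 (negPf on_0) /= => ->.
    have := a_lt; move: lt_ij; rewrite jn /= /off_chain /block_col; lia.
  by apply: richardson_exp_centralizer; lia.
- move=> [i j] [k l]; rewrite !P_mem /=.
  move=> /andP[lt_ij pivot_ij] /andP[lt_kl pivot_kl].
  rewrite /b /=; case: ifP => [off_ij | ].
    by rewrite mxE xpair_eqE ![_ == k]eq_sym ![_ == l]eq_sym.
  move/negbT; rewrite negb_or => /andP[on_i on_j].
  rewrite richardson_expE; last by lia.
  have i0 : i = ord0 by case/orP: pivot_ij => [/eqP //|]; rewrite (negPf on_i).
  congr (nat_of_bool _)%:R; apply/and3P/eqP => [[on_k on_l /eqP lk] | [<- <-]].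
    have k0 : k = ord0 by case/orP: pivot_kl => [/eqP //|]; rewrite (negPf on_k).
    rewrite i0 k0; congr pair; apply/val_inj/(@block_col_inj a) => //.
    by rewrite lk k0.
  by rewrite on_i on_j i0.
move=> z zc z_pivot; apply: centralizer_eq0 => // i j lt_ij pivot_ij.
by apply: (z_pivot (i, j)); rewrite P_mem lt_ij.
Qed.

End Hook.

Theorem theorem3p4 (K : closedFieldType) (p : nat) (charK : p \in [pchar K])
    (n : nat) (n_gt2 : (2 < n)%N) (d : seq nat) (dimd : is_dim_vector n d)
    (levi2 : #|levi_simple_roots n d| = 2%N)
    (partx : is_of_partition (richardson K n d) [:: 1; 1; n.-1]%N) :
  let e := mx_unit K n in
  let x := richardson K n d in
  let powers := [seq x ^+ k | k <- index_iota 1 n.-1] in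
  let c := centralizer (nilradical K n d) x in
  [/\ levi_simple_roots n d = simple_roots n [:: 1; 2]%N ->
        basis_of c ([:: e 2 n.+1; e 3 n.+1]%N ++ powers),
      forall r : nat, (1 < r < n.-1)%N ->
        levi_simple_roots n d = simple_roots n [:: r; r.+1] ->
        basis_of c ([:: e 1 r.+1; e 1 r.+2; e r.+1 n.+1; e r.+2 n.+1]%N
                      ++ powers) &
      levi_simple_roots n d = simple_roots n [:: n.-1; n] ->
        basis_of c ([:: e 1 n; e 1 n.+1]%N ++ powers)].
Proof.
move=> e x powers c; split=> [levi_d | r r_bounds levi_d | levi_d].
- apply: (@centralizer_basis K n 0 d _ dimd levi_d [:: (1, n); (2, n)]%N) => //.
    lia.
  by move=> i j; rewrite !inE !xpair_eqE /off_chain /block_col; lia.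
- case: r r_bounds levi_d => // a a_bounds levi_d.
  apply: (@centralizer_basis K n a d _ dimd levi_d
            [:: (0, a.+1); (0, a.+2); (a.+1, n); (a.+2, n)]%N) => //.
  + lia.
  + rewrite /= !inE !xpair_eqE; lia.
  by move=> i j; rewrite !inE !xpair_eqE /off_chain /block_col; lia.
have {}levi_d : levi_simple_roots n d = simple_roots n [:: n.-2.+1; n.-2.+2].
  by rewrite levi_d; congr (simple_roots n [:: _; _]); lia.
have -> : [:: e 1 n; e 1 n.+1] = [:: e 1 n.-2.+2; e 1 n.-2.+3]%N.
  by congr [:: e _ _; e _ _]; lia.
apply: (@centralizer_basis K n n.-2 d _ dimd levi_d
          [:: (0, n.-2.+1); (0, n.-2.+2)]%N) => //.
- lia.
- rewrite /= !inE !xpair_eqE; lia.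
by move=> i j; rewrite !inE !xpair_eqE /off_chain /block_col; lia.
Qed.
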